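(* Let $m,n\ge1$ be integers and let $P\in\mathbb{R}$ be such that $0\le P\le n^2\le m^2\left(\tfrac{21}{22}\right)^2$. Then $\Theta_m$ is linearly stable with respect to $\Theta_n$ for all $E_{\Theta_m}>0$.
   Context: $\Theta_m$ denotes any solution $\Theta_m:\mathbb{R}\to\mathbb{R}$ of the Duffing equation $$\ddot{\Theta}_m(t)+m^2(m^2-P)\Theta_m(t)+m^4\Theta_m(t)^3=0 ,$$ and its (constant) energy is $$E_{\Theta_m}=\frac{\dot{\Theta}_m(0)^2}{2}+\frac{m^2(m^2-P)}{2}\Theta_m(0)^2+\frac{m^4}{4}\Theta_m(0)^4 .$$ The assertion holds for every solution $\Theta_m$ whose energy lies in the indicated range. $\Theta_m$ is said to be linearly stable (unstable) with respect to the $n$-th mode $\Theta_n$ if $\xi\equiv0$ is a stable (unstable) solution of the Hill equation $$\ddot{\xi}+a(t)\xi=0,\qquad a(t)=n^2(n^2-P)+m^2n^2\Theta_m(t)^2 ;$$ stability of $\xi\equiv0$ is equivalent to all solutions $\xi$ being bounded on $\mathbb{R}$, and unstable means not stable. *)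

(* Defs.v *)
From Stdlib Require Import Reals.
From Coquelicot Require Import Coquelicot.
Open Scope R_scope.

(* Differentiability of [f] itself must be asked for explicitly: [Derive] is
   total, so [ex_derive (Derive f) t] (or [ex_derive_n f 2 t]) alone does not
   imply it. *)
Definition twice_derivable (f : R -> R) : Prop :=
  forall t : R, ex_derive f t /\ ex_derive (Derive f) t.

Definition duffing_solution (m : nat) (P : R) (Theta : R -> R) : Prop :=
  twice_derivable Theta /\
  forall t : R,
    Derive_n Theta 2 t + INR m ^ 2 * (INR m ^ 2 - P) * Theta t
      + INR m ^ 4 * Theta t ^ 3 = 0.

Definition duffing_energy (m : nat) (P : R) (Theta : R -> R) : R :=
  Derive Theta 0 ^ 2 / 2 + INR m ^ 2 * (INR m ^ 2 - P) / 2 * Theta 0 ^ 2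
    + INR m ^ 4 / 4 * Theta 0 ^ 4.

Definition hill_solution (a xi : R -> R) : Prop :=
  twice_derivable xi /\ forall t : R, Derive_n xi 2 t + a t * xi t = 0.

(* Lyapunov stability of the zero solution in the phase space (xi, xi'), for
   all times t in R, both before and after the initial time t0. *)
Definition hill_zero_stable (a : R -> R) : Prop :=
  forall t0 eps : R, 0 < eps ->
  exists delta : R, 0 < delta /\
    forall xi : R -> R, hill_solution a xi ->
      Rabs (xi t0) < delta -> Rabs (Derive xi t0) < delta ->
      forall t : R, Rabs (xi t) < eps /\ Rabs (Derive xi t) < eps.

Definition hill_coefficient (m n : nat) (P : R) (Theta : R -> R) (t : R) : R :=
  INR n ^ 2 * (INR n ^ 2 - P) + INR m ^ 2 * INR n ^ 2 * Theta t ^ 2.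

Definition linearly_stable (m n : nat) (P : R) (Theta : R -> R) : Prop :=
  hill_zero_stable (hill_coefficient m n P Theta).

(* Main.v *)
(** Let [c] be a crest of [Theta] (critical point with [Theta c > 0], up to
    sign) and [d] the next zero.  The coefficient [a] of the Hill equation is
    symmetric about [c] and about [d], and [0 <= a < b] where
    [Theta'' = - b Theta].  Sturm comparison on [[c, d]] with [Theta] gives
    [u > 0 > u'] at [d] for the solution with [u c = 1], [u' c = 0];
    comparison with [- Theta'] gives [v, v' > 0] at [d] for the solution with
    [v c = 0], [v' c = 1].  Hence
    [- u(d) u'(d) xi(c)^2 + v(d) v'(d) xi'(c)^2]
    is a positive definite quadratic form on solutions.  It is invariant under
    reflection in [c] and in [d], so every solution at every time can be folded
    back to [[c, d]], where Gronwall's inequality bounds it. *)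

Require Import Defs.
From Stdlib Require Import Reals Lra Classical.
From Coquelicot Require Import Coquelicot.
Open Scope R_scope.

(** * Calculus on the line: mean values and first zeros *)

(** The velocity is carried as a separate function, so that reflections and linear combinations of
    solutions have explicit velocities. *)
Definition solves (a u du : R -> R) : Prop :=
  forall t : R, is_derive u t (du t) /\ is_derive du t (- a t * u t).

Ltac derive_using :=
  auto_derive; [repeat split; eexists; eassumption|];
  repeat match goal with
  | H : is_derive ?f ?x ?l |- context [Derive ?g ?x] =>
    rewrite (is_derive_unique g x l H)
  end.

Lemma mean_value (f df : R -> R) (a b : R) :
  (forall t, is_derive f t (df t)) -> a < b ->
  exists e, a < e < b /\ f b - f a = df e * (b - a).
Proof.
intros Hf ab.
destruct (MVT_cor2 f df a b ab) as [e [He1 He2]].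
- intros t _; apply is_derive_Reals, Hf.
- exists e; split; assumption.
Qed.

Lemma derive_zero_const (f : R -> R) :
  (forall t, is_derive f t 0) -> forall s t, f s = f t.
Proof.
intros Hf.
assert (H : forall s t, s < t -> f s = f t).
{ intros s t st.
  destruct (mean_value f (fun _ => 0) s t Hf st) as [e [_ He]]; lra. }
intros s t; destruct (Rtotal_order s t) as [st | [st | st]].
- now apply H.
- now subst.
- symmetry; now apply H.
Qed.

Lemma derive_nonpos_decreasing (f df : R -> R) (s t : R) :
  (forall x, is_derive f x (df x)) -> (forall x, s < x < t -> df x <= 0) ->
  s <= t -> f t <= f s.
Proof.
intros Hf Hneg st.
destruct (Req_dec s t) as [-> | ne]; [lra|].
destruct (mean_value f df s t Hf) as [e [He1 He2]]; [lra|].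
specialize (Hneg e He1); nra.
Qed.

(** The zero is the supremum of the points up to which [f] stays positive; continuity rules out
    either sign there. *)
Lemma first_zero (f : R -> R) (a b : R) :
  (forall x, continuous f x) -> a < b -> 0 < f a -> f b <= 0 ->
  exists e, a < e <= b /\ f e = 0 /\ forall x, a <= x < e -> 0 < f x.
Proof.
intros Hf ab fa fb.
assert (loc : forall x eps, 0 < eps ->
  exists d, 0 < d /\ forall y, Rabs (y - x) < d -> Rabs (f y - f x) < eps).
{ intros x eps Heps.
  destruct (proj1 (filterlim_locally f (f x)) (Hf x) (mkposreal eps Heps))
    as [d Hd].
  exists d; split; [apply cond_pos|]. intros y Hy; apply (Hd y Hy). }
set (S := fun x => a <= x <= b /\ forall y, a <= y <= x -> 0 < f y).
assert (Sa : S a).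
{ split; [lra|]. intros y Hy. now replace y with a by lra. }
destruct (completeness S) as [e [He1 He2]].
- exists b; intros x [Hx _]; lra.
- now exists a.
- assert (ae : a <= e) by now apply He1.
  assert (eb : e <= b) by (apply He2; intros x [Hx _]; lra).
  assert (near : forall y, y < e -> exists x, S x /\ y < x).
  { intros y ye; apply NNPP; intros H.
    assert (e <= y); [|lra]. apply He2; intros x Sx.
    destruct (Rle_or_lt x y) as [|yx]; [assumption|]. exfalso; eauto. }
  assert (before : forall x, a <= x < e -> 0 < f x).
  { intros x Hx. destruct (near x) as [z [[_ Hz] xz]]; [lra|].
    apply Hz; lra. }
  destruct (Rtotal_order (f e) 0) as [neg | [zero | pos]].
  + exfalso. destruct (loc e (- f e)) as [d [d0 Hd]]; [lra|].
    destruct (near (e - d)) as [x [Sx xd]]; [lra|].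
    assert (x <= e) by now apply He1.
    assert (0 < f x) by (apply Sx; destruct Sx; lra).
    specialize (Hd x). rewrite Rabs_left1 in Hd by lra.
    specialize (Hd ltac:(lra)). apply Rabs_def2 in Hd; lra.
  + exists e; repeat split; try assumption.
    destruct (Req_dec a e) as [<- | ne]; lra.
  + exfalso. destruct (loc e (f e)) as [d [d0 Hd]]; [lra|].
    assert (e < b) by (destruct (Req_dec e b) as [-> | ne]; lra).
    (* A point beyond [e], but within [b] and the neighbourhood where [f] is positive; it still lies
       in [S], against the choice of [e]. *)
    pose (x := Rmin b (e + d / 2)).
    assert (xb : e < x) by (apply Rmin_glb_lt; lra).
    pose proof (Rmin_l b (e + d / 2)) as x1.
    pose proof (Rmin_r b (e + d / 2)) as x2. fold x in x1, x2.
    assert (S x); [|assert (x <= e) by (now apply He1); lra].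
    split; [lra|]. intros y Hy.
    destruct (Rlt_or_le y e) as [ye | ye]; [apply before; lra|].
    specialize (Hd y). rewrite Rabs_right in Hd by lra.
    specialize (Hd ltac:(lra)). apply Rabs_def2 in Hd; lra.
Qed.

(** * Linear second-order equations: superposition, reflection, Wronskian *)

Lemma solves_continuous (a u du : R -> R) :
  solves a u du ->
  (forall t, continuous u t) /\ (forall t, continuous du t).
Proof.
intros Hu; split; intros t; apply @ex_derive_continuous.
- exists (du t); apply Hu.
- exists (- a t * u t); apply Hu.
Qed.

Lemma solves_lin (a u du v dv : R -> R) (x y : R) :
  solves a u du -> solves a v dv ->
  solves a (fun t => x * u t + y * v t) (fun t => x * du t + y * dv t).
Proof.
intros Hu Hv t; destruct (Hu t) as [u1 u2], (Hv t) as [v1 v2]; split.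
- derive_using; ring.
- derive_using; ring.
Qed.

Lemma is_derive_reflect (f : R -> R) (c t l : R) :
  is_derive f (2 * c - t) l -> is_derive (fun s => f (2 * c - s)) t (- l).
Proof.
intros Hf. change (2 * c - t) with (2 * c + - t) in Hf.
derive_using; ring.
Qed.

Lemma solves_reflect (a u du : R -> R) (c : R) :
  (forall t, a (2 * c - t) = a t) -> solves a u du ->
  solves a (fun t => u (2 * c - t)) (fun t => - du (2 * c - t)).
Proof.
intros Ha Hu t; destruct (Hu (2 * c - t)) as [u1 u2]; split.
- now apply is_derive_reflect.
- replace (- a t * u (2 * c - t)) with (- - (- a t * u (2 * c - t))) by ring.
  apply @is_derive_opp, is_derive_reflect. now rewrite <- (Ha t).
Qed.

(** The identity behind every Sturm comparison below: while both solutions are positive, the sign of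
    [a - b] decides whether their Wronskian rises or falls. *)
Lemma is_derive_wronskian (a b u du v dv : R -> R) (t : R) :
  solves a u du -> solves b v dv ->
  is_derive (fun s => u s * dv s - du s * v s) t ((a t - b t) * u t * v t).
Proof.
intros Hu Hv; destruct (Hu t) as [u1 u2], (Hv t) as [v1 v2].
derive_using; ring.
Qed.

Lemma wronskian_const (a u du v dv : R -> R) (s t : R) :
  solves a u du -> solves a v dv ->
  u s * dv s - du s * v s = u t * dv t - du t * v t.
Proof.
intros Hu Hv.
apply (derive_zero_const (fun x => u x * dv x - du x * v x)); intros x.
replace 0 with ((a x - a x) * u x * v x) by ring.
now apply is_derive_wronskian.
Qed.

(** * Gronwall bounds and uniqueness *)

(** The product [f x * exp (- L * x)] is nonincreasing. *)
Lemma gronwall_forward (f df : R -> R) (L s t : R) :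
  (forall x, is_derive f x (df x)) -> (forall x, df x <= L * f x) ->
  s <= t -> f t <= f s * exp (L * (t - s)).
Proof.
intros Hf Hdf st.
assert (H : f t * exp (- L * t) <= f s * exp (- L * s)).
{ apply (derive_nonpos_decreasing (fun x => f x * exp (- L * x))
    (fun x => (df x - L * f x) * exp (- L * x))).
  - intros x; specialize (Hf x).
    derive_using; ring.
  - intros x _. specialize (Hdf x). pose proof (exp_pos (- L * x)); nra.
  - assumption. }
replace (L * (t - s)) with (- L * s + L * t) by ring.
rewrite exp_plus.
replace (f t) with ((f t * exp (- L * t)) * exp (L * t)).
- rewrite <- Rmult_assoc. apply Rmult_le_compat_r; [|assumption].
  apply Rlt_le, exp_pos.
- rewrite Rmult_assoc, <- exp_plus.
  replace (- L * t + L * t) with 0 by ring. rewrite exp_0; ring.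
Qed.

(** The derivative [2 * u * du * (1 - a)] of [u ^ 2 + du ^ 2] is bounded in absolute value by
    [1 + K] times that sum, which serves both time directions. *)
Lemma solves_growth (a u du : R -> R) (K s t : R) :
  (forall x, Rabs (a x) <= K) -> solves a u du ->
  u t ^ 2 + du t ^ 2 <= (u s ^ 2 + du s ^ 2) * exp ((1 + K) * Rabs (t - s)).
Proof.
intros HK Hu.
pose (f := fun x => u x ^ 2 + du x ^ 2).
pose (df := fun x => 2 * u x * du x * (1 - a x)).
assert (Hf : forall x, is_derive f x (df x)).
{ intros x; destruct (Hu x) as [u1 u2]; unfold f, df.
  derive_using; ring. }
assert (Hdf : forall x, Rabs (df x) <= (1 + K) * f x).
{ intros x; unfold df, f. specialize (HK x). rewrite Rabs_mult.
  pose proof (Rabs_triang 1 (- a x)) as Ha.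
  rewrite Rabs_Ropp, (Rabs_right 1) in Ha by lra.
  replace (1 + - a x) with (1 - a x) in Ha by ring.
  assert (H : Rabs (2 * u x * du x) <= u x ^ 2 + du x ^ 2)
    by (apply Rabs_le; pose proof (pow2_ge_0 (u x + du x));
        pose proof (pow2_ge_0 (u x - du x)); lra).
  rewrite (Rmult_comm (1 + K)).
  apply Rmult_le_compat; try apply Rabs_pos; lra. }
change (f t <= f s * exp ((1 + K) * Rabs (t - s))).
destruct (Rle_or_lt s t) as [st | ts].
- rewrite (Rabs_right (t - s)) by lra.
  apply (gronwall_forward f df); [assumption| |assumption].
  intros x; eapply Rle_trans; [apply Rle_abs | apply Hdf].
- rewrite (Rabs_left (t - s)) by lra.
  pose proof (gronwall_forward (fun x => f (2 * 0 - x))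
    (fun x => - df (2 * 0 - x)) (1 + K) (- s) (- t)) as H.
  cbv beta in H.
  replace (2 * 0 - - s) with s in H by ring.
  replace (2 * 0 - - t) with t in H by ring.
  replace (- (t - s)) with (- t - - s) by ring.
  apply H; [| |lra].
  + intros x; apply is_derive_reflect, Hf.
  + intros x; specialize (Hdf (2 * 0 - x)).
    pose proof (Rle_abs (- df (2 * 0 - x))) as H'.
    rewrite Rabs_Ropp in H'; lra.
Qed.

Lemma solves_unique_zero (a u du : R -> R) (K s : R) :
  (forall x, Rabs (a x) <= K) -> solves a u du -> u s = 0 -> du s = 0 ->
  forall t, u t = 0 /\ du t = 0.
Proof.
intros HK Hu us dus t.
pose proof (solves_growth a u du K s t HK Hu) as H.
rewrite us, dus in H.
replace ((0 ^ 2 + 0 ^ 2) * _) with 0 in H by ring.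
split; nra.
Qed.

(** * Hill equations whose coefficient is symmetric about two points *)

Section SymmetricHill.

Variables (a : R -> R) (K c d : R).
Hypothesis a_bound : forall t, Rabs (a t) <= K.
Hypothesis cd : c < d.
Hypothesis a_sym_c : forall t, a (2 * c - t) = a t.
Hypothesis a_sym_d : forall t, a (2 * d - t) = a t.
Hypothesis even_signs : forall u du, solves a u du ->
  u c = 1 -> du c = 0 -> 0 < u d /\ du d < 0.
Hypothesis odd_signs : forall v dv, solves a v dv ->
  v c = 0 -> dv c = 1 -> 0 < v d /\ 0 < dv d.

(* No existence theorem is needed: reflecting one nontrivial solution in [c]
   and then in [d] produces a whole fundamental system. *)
Lemma fundamental_system_or_trivial :
  (forall u du, solves a u du -> forall t, u t = 0 /\ du t = 0) \/
  exists u du v dv, solves a u du /\ solves a v dv /\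
    u c = 1 /\ du c = 0 /\ v c = 0 /\ dv c = 1.
Proof.
destruct (classic (forall u du, solves a u du -> u c = 0 /\ du c = 0))
  as [triv | nontriv].
{ left; intros u du Hu. destruct (triv u du Hu).
  now apply (solves_unique_zero a u du K c). }
right.
(* If [u c] or [du c] is nonzero, the even or the odd part of [u] about [c], normalised there, falls
   under [even_signs] or [odd_signs]. *)
assert (Hw : exists w dw, solves a w dw /\ w d <> 0 /\ dw d <> 0).
{ apply NNPP; intros no; apply nontriv; intros u du Hu.
  pose proof (solves_reflect a u du c a_sym_c Hu) as Hr.
  assert (E : 2 * c - c = c) by ring.
  split; apply NNPP; intros ne; apply no.
  - pose proof (solves_lin a _ _ _ _ (/ (2 * u c)) (/ (2 * u c)) Hu Hr) as H.
    eexists; eexists; split; [exact H|].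
    destruct (even_signs _ _ H) as [p q]; try (rewrite E; field; assumption).
    split; [apply Rgt_not_eq, p | apply Rlt_not_eq, q].
  - pose proof (solves_lin a _ _ _ _ (/ (2 * du c)) (- / (2 * du c)) Hu Hr)
      as H.
    eexists; eexists; split; [exact H|].
    destruct (odd_signs _ _ H) as [p q]; try (rewrite E; field; assumption).
    split; [apply Rgt_not_eq, p | apply Rgt_not_eq, q]. }
destruct Hw as (w & dw & Hw & w0 & dw0).
pose proof (solves_reflect a w dw d a_sym_d Hw) as Hr.
(* The even and odd parts of [w] about [d], normalised to data (1, 0) and (0, 1) at [d]. Their
   Wronskian is 1 at [d], hence also at [c]. *)
pose proof (solves_lin a _ _ _ _ (/ (2 * w d)) (/ (2 * w d)) Hw Hr) as Hp.
pose proof (solves_lin a _ _ _ _ (/ (2 * dw d)) (- / (2 * dw d)) Hw Hr) as Hq.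
pose proof (wronskian_const a _ _ _ _ c d Hp Hq) as W.
cbv beta in W. replace (2 * d - d) with d in W by ring.
set (p := fun t => / (2 * w d) * w t + / (2 * w d) * w (2 * d - t)) in *.
set (dp := fun t => / (2 * w d) * dw t + / (2 * w d) * - dw (2 * d - t)) in *.
set (q := fun t => / (2 * dw d) * w t + - / (2 * dw d) * w (2 * d - t)) in *.
set (dq := fun t => / (2 * dw d) * dw t + - / (2 * dw d) * - dw (2 * d - t))
  in *.
assert (W1 : p c * dq c - dp c * q c = 1).
{ etransitivity; [exact W | field; now split]. }
(* The coefficients come from inverting the matrix of the data of [p] and [q] at [c], whose
   determinant is 1 by [W1]. *)
do 4 eexists; split; [exact (solves_lin a _ _ _ _ (dq c) (- dp c) Hp Hq)|].
split; [exact (solves_lin a _ _ _ _ (- q c) (p c) Hp Hq)|].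
cbv beta; clearbody p dp q dq; repeat split; lra.
Qed.

Section InvariantForm.

Variables u du v dv : R -> R.
Hypothesis Hu : solves a u du.
Hypothesis Hv : solves a v dv.
Hypothesis uc : u c = 1.
Hypothesis duc : du c = 0.
Hypothesis vc : v c = 0.
Hypothesis dvc : dv c = 1.

(** The two weights are chosen so that the cross term cancels when the form is rewritten in the data
    at [d]. Reflection in [c] or [d] merely flips the velocity at that point, which a form without
    cross term does not see. *)
Definition inv_form (xi dxi : R -> R) : R :=
  - u d * du d * xi c ^ 2 + v d * dv d * dxi c ^ 2.

Lemma inv_form_reflect_c (xi dxi : R -> R) :
  inv_form (fun t => xi (2 * c - t)) (fun t => - dxi (2 * c - t))
    = inv_form xi dxi.
Proof.
unfold inv_form. replace (2 * c - c) with c by ring. ring.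
Qed.

(* Expressed through the data at [d], the form has again no mixed term. *)
Lemma inv_form_at_d (xi dxi : R -> R) :
  solves a xi dxi ->
  inv_form xi dxi =
    (- u d * du d * dv d ^ 2 + v d * dv d * du d ^ 2) * xi d ^ 2
    + (- u d * du d * v d ^ 2 + v d * dv d * u d ^ 2) * dxi d ^ 2.
Proof.
intros Hx.
pose proof (wronskian_const a _ _ _ _ c d Hx Hv) as x1.
pose proof (wronskian_const a _ _ _ _ c d Hu Hx) as x2.
rewrite vc, dvc in x1; rewrite uc, duc in x2.
unfold inv_form.
replace (xi c) with (xi d * dv d - dxi d * v d) by lra.
replace (dxi c) with (u d * dxi d - du d * xi d) by lra.
ring.
Qed.

Lemma inv_form_reflect_d (xi dxi : R -> R) :
  solves a xi dxi ->
  inv_form (fun t => xi (2 * d - t)) (fun t => - dxi (2 * d - t))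
    = inv_form xi dxi.
Proof.
intros Hx.
rewrite (inv_form_at_d _ _ Hx),
  (inv_form_at_d _ _ (solves_reflect a _ _ d a_sym_d Hx)).
replace (2 * d - d) with d by ring. ring.
Qed.

(** Induction on the number of cells of length [d - c] to the right of [c]. Reflection in [d] brings
    a time of the second cell into the first; for a later time, a further reflection in [c] makes
    the total effect a shift to the left by two cells. *)
Lemma fold_into_cell (k : nat) : forall (xi dxi : R -> R) (t : R),
  solves a xi dxi -> c <= t <= c + (INR k + 1) * (d - c) ->
  exists eta deta s, solves a eta deta /\ c <= s <= d /\
    inv_form eta deta = inv_form xi dxi /\
    xi t ^ 2 + dxi t ^ 2 = eta s ^ 2 + deta s ^ 2.
Proof.
induction k as [|k IH]; intros xi dxi t Hx Ht.
{ simpl in Ht. exists xi, dxi, t; repeat split; try apply Hx; lra. }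
destruct (Rle_or_lt t (c + (INR k + 1) * (d - c))) as [le | gt].
{ apply IH; [assumption | lra]. }
rewrite S_INR in Ht.
pose proof (pos_INR k) as k0.
assert (td : d < t) by nra.
pose proof (solves_reflect a _ _ d a_sym_d Hx) as H1.
pose proof (solves_reflect a _ _ c a_sym_c H1) as H2.
destruct (Rle_or_lt c (2 * d - t)) as [tc | tc].
- destruct (IH _ _ (2 * d - t) H1) as (eta & deta & s & He & Hs & HQ & Hn).
  { split; [assumption|]. nra. }
  exists eta, deta, s; split; [assumption|]; split; [assumption|].
  split; [now rewrite HQ, inv_form_reflect_d|].
  rewrite <- Hn. replace (2 * d - (2 * d - t)) with t by ring. ring.
- destruct (IH _ _ (2 * c - (2 * d - t)) H2)
    as (eta & deta & s & He & Hs & HQ & Hn).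
  { split; nra. }
  exists eta, deta, s; split; [assumption|]; split; [assumption|].
  split.
  + rewrite HQ, <- (inv_form_reflect_d xi dxi Hx).
    apply (inv_form_reflect_c (fun t => xi (2 * d - t))
      (fun t => - dxi (2 * d - t))).
  + rewrite <- Hn.
    replace (2 * d - (2 * c - (2 * c - (2 * d - t)))) with t by ring. ring.
Qed.

Lemma fold_into_cell_all (xi dxi : R -> R) (t : R) :
  solves a xi dxi ->
  exists eta deta s, solves a eta deta /\ c <= s <= d /\
    inv_form eta deta = inv_form xi dxi /\
    xi t ^ 2 + dxi t ^ 2 = eta s ^ 2 + deta s ^ 2.
Proof.
assert (right : forall xi dxi t, solves a xi dxi -> c <= t ->
  exists eta deta s, solves a eta deta /\ c <= s <= d /\
    inv_form eta deta = inv_form xi dxi /\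
    xi t ^ 2 + dxi t ^ 2 = eta s ^ 2 + deta s ^ 2).
{ clear xi dxi t; intros xi dxi t Hx ct.
  destruct (INR_unbounded ((t - c) / (d - c))) as [k Hk].
  apply (fold_into_cell k); [assumption|]. split; [assumption|].
  apply Rmult_gt_compat_r with (r := d - c) in Hk; [|lra].
  unfold Rdiv in Hk. rewrite Rmult_assoc, Rinv_l in Hk by lra. nra. }
intros Hx. destruct (Rle_or_lt c t) as [ct | tc]; [now apply right|].
destruct (right _ _ (2 * c - t) (solves_reflect a _ _ c a_sym_c Hx))
  as (eta & deta & s & He & Hs & HQ & Hn); [lra|].
exists eta, deta, s; split; [assumption|]; split; [assumption|].
split; [now rewrite HQ, inv_form_reflect_c|].
rewrite <- Hn. replace (2 * c - (2 * c - t)) with t by ring. ring.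
Qed.

Lemma uniform_bound (t0 : R) :
  exists M, 0 < M /\ forall xi dxi, solves a xi dxi ->
    forall t, xi t ^ 2 + dxi t ^ 2 <= M * (xi t0 ^ 2 + dxi t0 ^ 2).
Proof.
destruct (even_signs u du Hu uc duc) as [ud dud].
destruct (odd_signs v dv Hv vc dvc) as [vd dvd].
pose (A := - u d * du d). pose (B := v d * dv d).
assert (A0 : 0 < A) by (unfold A; nra).
assert (B0 : 0 < B) by (unfold B; nra).
assert (K0 : 0 <= K).
{ eapply Rle_trans; [apply Rabs_pos | apply (a_bound 0)]. }
pose (X := exp ((1 + K) * (d - c))). pose (Y := exp ((1 + K) * Rabs (c - t0))).
assert (X0 : 0 < X) by apply exp_pos.
assert (Y0 : 0 < Y) by apply exp_pos.
assert (iA : 0 < / A) by now apply Rinv_0_lt_compat.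
assert (iB : 0 < / B) by now apply Rinv_0_lt_compat.
(* [Y] is the growth from [t0] to [c], [A + B] bounds the form by the data at [c], [/ A + / B]
   bounds the folded data at [c] by the form, and [X] is the growth inside the cell. *)
exists ((/ A + / B) * (A + B) * X * Y); split.
{ repeat apply Rmult_lt_0_compat; lra. }
intros xi dxi Hx t.
destruct (fold_into_cell_all xi dxi t Hx)
  as (eta & deta & s & He & Hs & HQ & Hn).
rewrite Hn.
assert (G1 : eta s ^ 2 + deta s ^ 2 <= (eta c ^ 2 + deta c ^ 2) * X).
{ eapply Rle_trans; [apply (solves_growth a eta deta K c s a_bound He)|].
  apply Rmult_le_compat_l; [nra|]. unfold X.
  rewrite Rabs_right by lra.
  destruct (Req_dec s d) as [-> | ne]; [lra|].
  apply Rlt_le, exp_increasing; nra. }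
pose proof (solves_growth a xi dxi K t0 c a_bound Hx) as G2. fold Y in G2.
unfold inv_form in HQ. fold A B in HQ.
set (Q := A * xi c ^ 2 + B * dxi c ^ 2) in *.
assert (G3 : eta c ^ 2 + deta c ^ 2 <= (/ A + / B) * Q).
{ rewrite <- HQ.
  replace ((/ A + / B) * _) with (eta c ^ 2 + deta c ^ 2
    + / A * B * deta c ^ 2 + / B * A * eta c ^ 2) by (field; lra).
  assert (0 <= / A * B * deta c ^ 2)
    by (apply Rmult_le_pos; [apply Rmult_le_pos; lra | nra]).
  assert (0 <= / B * A * eta c ^ 2)
    by (apply Rmult_le_pos; [apply Rmult_le_pos; lra | nra]).
  lra. }
assert (G4 : Q <= (A + B) * (xi c ^ 2 + dxi c ^ 2)) by (unfold Q; nra).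
eapply Rle_trans; [exact G1|].
replace ((/ A + / B) * (A + B) * X * Y * (xi t0 ^ 2 + dxi t0 ^ 2)) with
  ((/ A + / B) * ((A + B) * ((xi t0 ^ 2 + dxi t0 ^ 2) * Y)) * X) by ring.
apply Rmult_le_compat_r; [lra|].
eapply Rle_trans; [exact G3|].
apply Rmult_le_compat_l; [lra|].
eapply Rle_trans; [exact G4|].
apply Rmult_le_compat_l; lra.
Qed.

End InvariantForm.

Lemma symmetric_hill_stable : hill_zero_stable a.
Proof.
intros t0 eps eps0.
assert (HM : exists M, 0 < M /\ forall xi dxi, solves a xi dxi ->
  forall t, xi t ^ 2 + dxi t ^ 2 <= M * (xi t0 ^ 2 + dxi t0 ^ 2)).
{ destruct fundamental_system_or_trivial
    as [triv | (u & du & v & dv & Hu & Hv & H1 & H2 & H3 & H4)].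
  - exists 1; split; [lra|]. intros xi dxi Hx t.
    destruct (triv _ _ Hx t) as [-> ->], (triv _ _ Hx t0) as [-> ->]; lra.
  - now apply (uniform_bound u du v dv). }
destruct HM as [M [M0 HM]].
(* The data at [t0] contribute less than [2 * delta ^ 2], and [2 * M * delta ^ 2 < ((2 * M + 1) *
   delta) ^ 2 = eps ^ 2]; this choice avoids a square root. *)
exists (eps / (2 * M + 1)).
assert (iM : 0 < / (2 * M + 1)) by (apply Rinv_0_lt_compat; lra).
split; [now apply Rmult_lt_0_compat|].
set (delta := eps / (2 * M + 1)).
assert (ed : eps = (2 * M + 1) * delta) by (unfold delta; field; lra).
assert (d0 : 0 < delta) by now apply Rmult_lt_0_compat.
intros xi [Hd Heq] x0 dx0 t.
assert (Hx : solves a xi (Derive xi)).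
{ intros s; destruct (Hd s) as [d1 d2]; split; [now apply Derive_correct|].
  specialize (Heq s). change (Derive_n xi 2 s) with (Derive (Derive xi) s) in Heq.
  replace (- a s * xi s) with (Derive (Derive xi) s) by lra.
  now apply Derive_correct. }
specialize (HM _ _ Hx t).
apply Rabs_def2 in x0; apply Rabs_def2 in dx0.
assert (xi t0 ^ 2 < delta ^ 2) by nra.
assert (Derive xi t0 ^ 2 < delta ^ 2) by nra.
assert (Hlt : xi t ^ 2 + Derive xi t ^ 2 < eps ^ 2) by (rewrite ed; nra).
pose proof (pow2_ge_0 (xi t)); pose proof (pow2_ge_0 (Derive xi t)).
split; apply Rabs_def1; nra.
Qed.

End SymmetricHill.

(** * Sturm comparison on one cell *)

(** The Wronskian [u * dw - du * w] is 0 at [c] and strictly decreases while [u] is positive. At a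
    first zero [e] of [u] it would equal [- du e * w e >= 0], a contradiction. So [u] stays positive
    and concavity makes [du d] negative. *)
Lemma even_signs_of_comparison (a b u du w dw : R -> R) (c d : R) :
  solves a u du -> solves b w dw -> c < d ->
  (forall t, c <= t < d -> 0 < w t) -> w d = 0 -> dw c = 0 ->
  (forall t, c < t < d -> 0 < a t < b t) ->
  u c = 1 -> du c = 0 -> 0 < u d /\ du d < 0.
Proof.
intros Hu Hw cd w0 wd dwc ab uc duc.
assert (du_decr : forall e, c < e <= d -> (forall t, c <= t < e -> 0 < u t) ->
  du e < 0).
{ intros e He pos.
  destruct (mean_value du (fun t => - a t * u t) c e) as [z [Hz Ez]];
    [intros t; apply Hu | lra |].
  specialize (pos z ltac:(lra)). destruct (ab z) as [az _]; [lra|].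
  assert (0 < a z * u z * (e - c)) by (repeat apply Rmult_lt_0_compat; lra).
  lra. }
assert (upos : forall t, c <= t <= d -> 0 < u t).
{ intros t Ht; apply Rnot_le_lt; intros ut.
  assert (ct : c < t) by (destruct (Req_dec c t) as [<- |]; lra).
  destruct (first_zero u c t) as [e (He & ue & pos)]; try lra.
  { apply (solves_continuous a u du Hu). }
  destruct (mean_value (fun s => u s * dw s - du s * w s)
    (fun s => (a s - b s) * u s * w s) c e) as [z [Hz Ez]];
    [intros s; now apply is_derive_wronskian | lra |].
  cbv beta in Ez. rewrite ue, uc, duc, dwc in Ez.
  specialize (pos z ltac:(lra)) as uz.
  specialize (w0 z ltac:(lra)) as wz. destruct (ab z) as [_ abz]; [lra|].
  assert (0 < (b z - a z) * u z * w z * (e - c))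
    by (repeat apply Rmult_lt_0_compat; lra).
  assert (du e < 0) by (apply du_decr; [lra | assumption]).
  assert (0 <= w e).
  { destruct (Req_dec e d) as [-> | ne]; [lra|]. apply Rlt_le, w0; lra. }
  nra. }
split; [apply upos; lra|].
apply du_decr; [lra|]. intros t Ht; apply upos; lra.
Qed.

(** The same argument at a first zero [e] of [dv]: the Wronskian [v * dp - dv * p] starts at 0 and
    strictly decreases, yet would equal [v e * dp e >= 0]. *)
Lemma odd_signs_of_comparison (a b v dv p dp : R -> R) (c d : R) :
  solves a v dv -> solves b p dp -> c < d ->
  (forall t, c < t <= d -> 0 < p t) -> p c = 0 ->
  (forall t, c <= t <= d -> 0 <= dp t) ->
  (forall t, c < t < d -> a t < b t) ->
  v c = 0 -> dv c = 1 -> 0 < v d /\ 0 < dv d.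
Proof.
intros Hv Hp cd p0 pc dp0 ab vc dvc.
assert (v_incr : forall e, c < e -> (forall t, c <= t < e -> 0 < dv t) ->
  0 < v e).
{ intros e He pos.
  destruct (mean_value v dv c e) as [z [Hz Ez]]; [apply Hv | lra |].
  specialize (pos z ltac:(lra)). nra. }
assert (dvpos : forall t, c <= t <= d -> 0 < dv t).
{ intros t Ht; apply Rnot_le_lt; intros dvt.
  assert (ct : c < t) by (destruct (Req_dec c t) as [<- |]; lra).
  destruct (first_zero dv c t) as [e (He & dve & pos)]; try lra.
  { apply (solves_continuous a v dv Hv). }
  destruct (mean_value (fun s => v s * dp s - dv s * p s)
    (fun s => (a s - b s) * v s * p s) c e) as [z [Hz Ez]];
    [intros s; now apply is_derive_wronskian | lra |].
  cbv beta in Ez. rewrite dve, vc, pc in Ez.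
  assert (vz : 0 < v z) by (apply v_incr; [lra | intros; apply pos; lra]).
  assert (ve : 0 < v e) by (apply v_incr; [lra | assumption]).
  specialize (p0 z ltac:(lra)). specialize (ab z ltac:(lra)).
  specialize (dp0 e ltac:(lra)).
  assert (0 < (b z - a z) * v z * p z * (e - c))
    by (repeat apply Rmult_lt_0_compat; lra).
  nra. }
split; [|apply dvpos; lra].
apply v_incr; [lra|]. intros t Ht; apply dvpos; lra.
Qed.

(** * The Duffing equation: energy, symmetries, oscillation *)

Section Duffing.

Variables (alpha beta : R).
Hypothesis alpha0 : 0 < alpha.
Hypothesis beta0 : 0 < beta.

(** The nonlinear equation is read as a linear one whose coefficient depends on the solution itself,
    so the lemmas on [solves] apply. *)
Definition duffing_pair (w dw : R -> R) : Prop :=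
  solves (fun t => alpha + beta * w t ^ 2) w dw.

Definition pair_energy (w dw : R -> R) (t : R) : R :=
  dw t ^ 2 / 2 + alpha / 2 * w t ^ 2 + beta / 4 * w t ^ 4.

Lemma pair_energy_const (w dw : R -> R) (s t : R) :
  duffing_pair w dw -> pair_energy w dw s = pair_energy w dw t.
Proof.
intros Hw; apply derive_zero_const; intros x.
destruct (Hw x) as [w1 w2]; unfold pair_energy.
derive_using; field.
Qed.

(** All terms of the conserved energy are nonnegative, so it dominates [alpha / 2 * w t ^ 2]. *)
Lemma duffing_bounded (w dw : R -> R) :
  duffing_pair w dw -> exists N, 0 <= N /\ forall t, w t ^ 2 <= N.
Proof.
intros Hw; exists (2 / alpha * pair_energy w dw 0).
assert (ia : 0 < / alpha) by now apply Rinv_0_lt_compat.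
assert (H : forall t, w t ^ 2 <= 2 / alpha * pair_energy w dw 0).
{ intros t; rewrite (pair_energy_const w dw 0 t Hw); unfold pair_energy.
  replace (2 / alpha * _) with
    (w t ^ 2 + / alpha * (dw t ^ 2 + beta / 2 * (w t ^ 2) ^ 2)) by (field; lra).
  assert (0 <= / alpha * (dw t ^ 2 + beta / 2 * (w t ^ 2) ^ 2)).
  { apply Rmult_le_pos; [lra|].
    pose proof (pow2_ge_0 (dw t)); pose proof (pow2_ge_0 (w t ^ 2)); nra. }
  lra. }
split; [|assumption].
eapply Rle_trans; [apply (pow2_ge_0 (w 0)) | apply H].
Qed.

Lemma duffing_unique (w dw z dz : R -> R) (s : R) :
  duffing_pair w dw -> duffing_pair z dz -> w s = z s -> dw s = dz s ->
  forall t, w t = z t.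
Proof.
intros Hw Hz ws dws t.
destruct (duffing_bounded w dw Hw) as [N [N0 HN]].
destruct (duffing_bounded z dz Hz) as [N' [N0' HN']].
(* The difference solves the linear equation with the divided difference of
   the nonlinearity as coefficient. *)
assert (H : solves (fun x => alpha + beta * (w x ^ 2 + w x * z x + z x ^ 2))
  (fun x => w x - z x) (fun x => dw x - dz x)).
{ intros x; destruct (Hw x) as [w1 w2], (Hz x) as [z1 z2]; split.
  - now apply @is_derive_minus.
  - replace (- _ * _) with (- (alpha + beta * w x ^ 2) * w x
      - (- (alpha + beta * z x ^ 2) * z x)) by ring.
    now apply @is_derive_minus. }
assert (HK : forall x,
  Rabs (alpha + beta * (w x ^ 2 + w x * z x + z x ^ 2))
    <= alpha + beta * (2 * (N + N'))); [|
  destruct (solves_unique_zero _ _ _ _ s HK H) with (t := t) as [E _]; lra].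
intros x; specialize (HN x); specialize (HN' x).
assert (0 <= w x ^ 2 + w x * z x + z x ^ 2 <= 2 * (N + N')) by (split; nra).
rewrite Rabs_right; nra.
Qed.

Lemma duffing_opp (w dw : R -> R) :
  duffing_pair w dw -> duffing_pair (fun t => - w t) (fun t => - dw t).
Proof.
intros Hw t; destruct (Hw t) as [w1 w2]; split.
- now apply @is_derive_opp.
- replace (- _ * _) with (- (- (alpha + beta * w t ^ 2) * w t)) by ring.
  now apply @is_derive_opp.
Qed.

Lemma duffing_reflect (w dw : R -> R) (c : R) :
  duffing_pair w dw ->
  duffing_pair (fun t => w (2 * c - t)) (fun t => - dw (2 * c - t)).
Proof.
intros Hw t; destruct (Hw (2 * c - t)) as [w1 w2]; split.
- now apply is_derive_reflect.
- replace (- _ * _) with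
    (- - (- (alpha + beta * w (2 * c - t) ^ 2) * w (2 * c - t))) by ring.
  now apply @is_derive_opp, is_derive_reflect.
Qed.

(** Differentiating the equation in time shows that the velocity solves the linearised equation; the
    sign is the one that is positive on the descent from a crest. *)
Lemma duffing_velocity (w dw : R -> R) :
  duffing_pair w dw ->
  solves (fun t => alpha + 3 * beta * w t ^ 2) (fun t => - dw t)
    (fun t => (alpha + beta * w t ^ 2) * w t).
Proof.
intros Hw t; destruct (Hw t) as [w1 w2]; split.
- replace ((alpha + _) * _) with (- (- (alpha + beta * w t ^ 2) * w t)) by ring.
  now apply @is_derive_opp.
- derive_using; ring.
Qed.

(** The distance between consecutive zeros of the linear oscillator of frequency [sqrt alpha]. *)
Definition half_wave : R := PI / sqrt alpha.

Lemma half_wave_pos : 0 < half_wave.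
Proof.
apply Rdiv_lt_0_compat; [apply PI_RGT_0 | now apply sqrt_lt_R0].
Qed.

(** Sturm comparison with a sine vanishing at both ends of the interval: for positive [w] the
    Wronskian would be nonincreasing, while its total change is
    [om * (w s + w (s + half_wave)) > 0]. *)
Lemma duffing_not_pos (w dw : R -> R) (s : R) :
  duffing_pair w dw ->
  ~ forall t, s <= t <= s + half_wave -> 0 < w t.
Proof.
intros Hw pos.
set (om := sqrt alpha).
assert (om0 : 0 < om) by now apply sqrt_lt_R0.
assert (om2 : om * om = alpha) by (apply sqrt_sqrt; lra).
pose proof half_wave_pos as T0.
assert (omT : om * half_wave = PI) by (unfold half_wave; fold om; field; lra).
assert (Hs : solves (fun _ => alpha) (fun t => sin (om * (t - s)))
  (fun t => om * cos (om * (t - s)))).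
{ clearbody om; unfold Rminus; intros t; split; auto_derive; trivial;
    [ring|].
  rewrite <- om2; ring. }
destruct (mean_value _ _ s (s + half_wave)
  (fun t => is_derive_wronskian _ _ _ _ _ _ t Hs Hw)) as [z [Hz Ez]]; [lra|].
cbv beta in Ez.
replace (om * (s + half_wave - s)) with PI in Ez by (rewrite <- omT; ring).
replace (om * (s - s)) with 0 in Ez by ring.
rewrite sin_PI, cos_PI, sin_0, cos_0 in Ez.
assert (0 < sin (om * (z - s))).
{ apply sin_gt_0; [apply Rmult_lt_0_compat; lra|].
  rewrite <- omT; apply Rmult_lt_compat_l; lra. }
pose proof (pos s ltac:(lra)) as ws.
pose proof (pos (s + half_wave) ltac:(lra)) as wt.
pose proof (pos z ltac:(lra)) as wz.
assert (0 <= beta * w z ^ 2 * sin (om * (z - s)) * w z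
  * (s + half_wave - s)).
{ repeat apply Rmult_le_pos; try lra; apply pow2_ge_0. }
nra.
Qed.

Lemma duffing_zero (w dw : R -> R) (s : R) :
  duffing_pair w dw ->
  exists t, s <= t <= s + half_wave /\ w t = 0.
Proof.
intros Hw; apply NNPP; intros no.
pose proof half_wave_pos as T0.
assert (sign : forall z dz, duffing_pair z dz -> 0 < z s ->
  exists t, s <= t <= s + half_wave /\ z t = 0).
{ intros z dz Hz zs.
  assert (H : exists t, s <= t <= s + half_wave /\ z t <= 0).
  { apply NNPP; intros H; apply (duffing_not_pos z dz s Hz).
    intros t Ht; apply Rnot_le_lt; intros zt; eauto. }
  destruct H as [t [Ht zt]].
  destruct (first_zero z s t) as [e (He & ze & _)]; try lra.
  - apply (solves_continuous _ _ _ Hz).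
  - destruct (Req_dec s t) as [<- |]; lra.
  - exists e; split; [lra | assumption]. }
destruct (Rtotal_order (w s) 0) as [neg | [zero | pos]].
- destruct (sign _ _ (duffing_opp w dw Hw)) as [t [Ht wt]]; [lra|].
  apply no; exists t; split; [assumption | lra].
- apply no; exists s; split; [lra | assumption].
- apply no. now apply (sign w dw).
Qed.

Lemma duffing_critical (w dw : R -> R) :
  duffing_pair w dw -> exists c, dw c = 0.
Proof.
intros Hw. pose proof half_wave_pos as T0.
destruct (duffing_zero w dw 0 Hw) as [s [Hs ws]].
(* Starting at [2 * half_wave] makes the second zero distinct from the first, which lies in
   [[0, half_wave]]. *)
destruct (duffing_zero w dw (2 * half_wave) Hw) as [t [Ht wt]].
destruct (mean_value w dw s t) as [c [_ Hc]]; [apply Hw | lra |].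
exists c. rewrite ws, wt in Hc. nra.
Qed.

(** By uniqueness [w] is even about [c] and odd about its next zero [d], so [w ^ 2] is symmetric
    about both. Between them the Hill coefficient lies below the coefficients of the equations
    solved by [w] and by [- dw]. *)
Lemma duffing_hill_stable_at_crest (w dw : R -> R) (c alpha' beta' : R) :
  duffing_pair w dw -> dw c = 0 -> 0 < w c ->
  0 <= alpha' < alpha -> 0 < beta' <= beta ->
  hill_zero_stable (fun t => alpha' + beta' * w t ^ 2).
Proof.
intros Hw dwc wc Ha Hb. pose proof half_wave_pos as T0.
destruct (duffing_zero w dw c Hw) as [t [Ht wt]].
destruct (first_zero w c t) as [d (Hd & wd & pos)]; try lra.
{ apply (solves_continuous _ _ _ Hw). }
{ destruct (Req_dec c t) as [<- |]; lra. }
assert (sym_c : forall s, w (2 * c - s) = w s).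
{ intros s.
  apply (duffing_unique _ _ w dw c (duffing_reflect w dw c Hw) Hw).
  - f_equal; ring.
  - replace (2 * c - c) with c by ring. lra. }
assert (sym_d : forall s, w (2 * d - s) = - w s).
{ intros s.
  apply (duffing_unique _ _ _ _ d (duffing_reflect w dw d Hw)
    (duffing_opp w dw Hw)); cbv beta; replace (2 * d - d) with d by ring; lra. }
destruct (duffing_bounded w dw Hw) as [N [N0 HN]].
assert (dwneg : forall s, c < s <= d -> 0 < - dw s).
{ intros s Hs.
  destruct (mean_value (fun t => - dw t)
    (fun t => (alpha + beta * w t ^ 2) * w t) c s) as [z [Hz Ez]];
    [apply (duffing_velocity w dw Hw) | lra |].
  cbv beta in Ez. rewrite dwc in Ez. specialize (pos z ltac:(lra)).
  assert (0 < (alpha + beta * w z ^ 2) * w z * (s - c)).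
  { repeat apply Rmult_lt_0_compat; try lra. pose proof (pow2_ge_0 (w z)); nra. }
  lra. }
apply (symmetric_hill_stable _ (alpha' + beta' * N) c d).
- intros s; specialize (HN s). pose proof (pow2_ge_0 (w s)).
  rewrite Rabs_right; nra.
- lra.
- intros s; now rewrite sym_c.
- intros s; rewrite sym_d; ring.
- intros u du Hu.
  apply (even_signs_of_comparison _ _ _ _ _ _ c d Hu Hw); try assumption; try lra.
  intros s Hs. specialize (pos s ltac:(lra)).
  (* Strict positivity keeps the Hill coefficient positive even when [alpha'] is 0. *)
  assert (0 < w s ^ 2) by nra. split; nra.
- intros v dv Hv.
  apply (odd_signs_of_comparison _ _ _ _ _ _ c d Hv (duffing_velocity w dw Hw));
    try assumption; try lra.
  + intros s Hs.
    assert (0 <= w s).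
    { destruct (Req_dec s d) as [-> | ne]; [lra|]. apply Rlt_le, pos; lra. }
    apply Rmult_le_pos; [pose proof (pow2_ge_0 (w s)); nra | assumption].
  + intros s Hs. pose proof (pow2_ge_0 (w s)). nra.
Qed.

End Duffing.

(** * Stability along every solution of positive energy *)

Lemma hill_zero_stable_ext (a b : R -> R) :
  (forall t, a t = b t) -> hill_zero_stable a -> hill_zero_stable b.
Proof.
intros E Ha t0 eps eps0. destruct (Ha t0 eps eps0) as [delta [d0 H]].
exists delta; split; [assumption|]. intros xi [Hd Hx]; apply H.
split; [assumption|]. intros t; now rewrite E.
Qed.

(** Positive energy prevents [w] from vanishing at a critical point. A trough becomes a crest of
    [- w], which has the same square. *)
Lemma duffing_hill_stable (alpha beta alpha' beta' : R) (w dw : R -> R) :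
  duffing_pair alpha beta w dw -> 0 < pair_energy alpha beta w dw 0 ->
  0 <= alpha' < alpha -> 0 < beta' <= beta ->
  hill_zero_stable (fun t => alpha' + beta' * w t ^ 2).
Proof.
intros Hw E0 Ha Hb.
assert (alpha0 : 0 < alpha) by lra. assert (beta0 : 0 < beta) by lra.
destruct (duffing_critical alpha beta alpha0 beta0 w dw Hw) as [c dwc].
destruct (Rtotal_order (w c) 0) as [neg | [zero | pos]].
- apply (hill_zero_stable_ext (fun t => alpha' + beta' * (- w t) ^ 2)).
  { intros t; ring. }
  apply (duffing_hill_stable_at_crest alpha beta alpha0 beta0 _ _ c
    alpha' beta' (duffing_opp alpha beta w dw Hw)); try assumption; lra.
- rewrite (pair_energy_const alpha beta w dw 0 c Hw) in E0.
  unfold pair_energy in E0. rewrite dwc, zero in E0. exfalso; lra.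
- now apply (duffing_hill_stable_at_crest alpha beta alpha0 beta0 w dw c).
Qed.

Theorem theorem6 (m n : nat) (P : R)
  (hm : (1 <= m)%nat) (hn : (1 <= n)%nat)
  (hP0 : 0 <= P) (hPn : P <= INR n ^ 2)
  (hnm : INR n ^ 2 <= INR m ^ 2 * (21 / 22) ^ 2)
  (Theta : R -> R) (hTheta : duffing_solution m P Theta)
  (hE : 0 < duffing_energy m P Theta) :
  linearly_stable m n P Theta.
Proof.
apply le_INR in hm, hn. simpl (INR 1) in hm, hn.
destruct hTheta as [Hd Heq].
assert (n2 : 1 <= INR n ^ 2) by nra.
(* The inequality is strict because [(21 / 22) ^ 2 < 1]. *)
assert (nm2 : INR n ^ 2 < INR m ^ 2) by nra.
pose (alpha := INR m ^ 2 * (INR m ^ 2 - P)). pose (beta := INR m ^ 4).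
assert (beta_eq : beta = INR m ^ 2 * INR m ^ 2) by (unfold beta; ring).
apply (duffing_hill_stable alpha beta _ _ Theta (Derive Theta)).
- intros t; destruct (Hd t) as [d1 d2]; split; [now apply Derive_correct|].
  specialize (Heq t).
  change (Derive_n Theta 2 t) with (Derive (Derive Theta) t) in Heq.
  replace (- _ * _) with (Derive (Derive Theta) t)
    by (unfold alpha, beta; lra).
  now apply Derive_correct.
- exact hE.
(* Here [alpha'] is [INR n ^ 2 * (INR n ^ 2 - P)]; its factors are nonnegative and each is smaller
   than the matching factor of [alpha]. *)
- split; unfold alpha; nra.
- rewrite beta_eq; split; nra.
Qed.
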